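(* Let $X$ be a Hausdorff topological space, let $f_1,\dots,f_k:X\to X$ be continuous maps, and let $A$ be a quasi-attractor of the IFS generated by $f_1,\dots,f_k$. If $A$ is well-fibred and $f_i(A)\neq A$ for some $i\in\{1,\dots,k\}$, then $A$ is strongly-fibred.
   Context: $\Gamma$ is the semigroup generated by $f_1,\dots,f_k$ (all compositions of one or more generators). A quasi-attractor is a non-empty compact set $A\subset X$ with $A=\bigcup_{i=1}^k f_i(A)$ and $A=\overline{\{g(x):g\in\Gamma\}}$ for all $x\in A$. A quasi-attractor $A$ is well-fibred if for every compact set $K\subset A$ with $K\neq A$ and every open cover $\mathcal{U}$ of $A$ there exist $g\in\Gamma$ and $U\in\mathcal{U}$ with $g(K)\subset U$. It is strongly-fibred if for every open set $U\subset X$ with $U\cap A\neq\emptyset$ there is $\omega\in\{1,\dots,k\}^{\mathbb{N}}$ with $\bigcap_{n=1}^\infty f_{\omega_1}\circ\cdots\circ f_{\omega_n}(A)\subset U$. *)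

(* Defs.v *)
From HB Require Import structures.
From mathcomp Require Import all_boot all_order all_algebra.
From mathcomp Require Import all_classical all_reals all_analysis.

Set Implicit Arguments.
Unset Strict Implicit.
Unset Printing Implicit Defensive.

Local Open Scope classical_set_scope.

Section IFS.
Variables (X : topologicalType) (k : nat) (f : 'I_k -> X -> X).

Inductive ifs_semigroup : set (X -> X) :=
| ifs_gen i : ifs_semigroup (f i)
| ifs_comp g h : ifs_semigroup g -> ifs_semigroup h -> ifs_semigroup (g \o h).

Definition quasi_attractor (A : set X) : Prop :=
  [/\ A !=set0, compact A,
      A = \bigcup_(i in [set: 'I_k]) (f i @` A) &
      forall x, A x -> A = closure [set g x | g in ifs_semigroup]].

(* Members of the cover are open in X; traces on A of such sets are exactly the
   relatively open subsets of A, and g @` K lies in A. *)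
Definition well_fibred (A : set X) : Prop :=
  forall K : set X, compact K -> K `<=` A -> K <> A ->
  forall C : set (set X), (forall U, C U -> open U) ->
    A `<=` \bigcup_(U in C) U ->
  exists2 g, ifs_semigroup g & exists2 U, C U & g @` K `<=` U.

(* Sequences are 0-indexed: with w i standing for omega_(i+1),
   ifs_branch w n is f_(omega_1) \o ... \o f_(omega_n). *)
Fixpoint ifs_branch (w : nat -> 'I_k) (n : nat) : X -> X :=
  if n is m.+1 then ifs_branch w m \o f (w m) else id.

Definition strongly_fibred (A : set X) : Prop :=
  forall U : set X, open U -> U `&` A !=set0 ->
  exists w : nat -> 'I_k,
    \bigcap_(n in [set n | (1 <= n)%N]) (ifs_branch w n @` A) `<=` U.

End IFS.

(* Main.v *)
(* Since every orbit is dense in A, the sets h^-1(U), h in the semigroup, cover A.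
   Well-fibredness for the proper compact subset f_i(A) and this cover gives
   g, h with h (g (f_i(A))) included in U; any sequence starting with a word
   for h \o g \o f_i then has its fibre in U. *)
Require Import Defs.
From mathcomp Require Import all_boot all_order all_algebra.
From mathcomp Require Import all_classical all_reals all_analysis.

Set Implicit Arguments.
Unset Strict Implicit.
Unset Printing Implicit Defensive.

Local Open Scope classical_set_scope.

Lemma eq_ifs_branch (X : topologicalType) (k : nat) (f : 'I_k -> X -> X)
    (w v : nat -> 'I_k) n :
  (forall j, (j < n)%N -> w j = v j) -> ifs_branch f w n = ifs_branch f v n.
Proof.
elim: n => // n IHn wv /=.
by rewrite wv // IHn // => j /ltnW; exact: wv.
Qed.

(** Induction on [m]: [ifs_branch] composes new letters on the right, so each step strips the
    innermost map of the [v] word. *)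
Lemma ifs_branch_cat (X : topologicalType) (k : nat) (f : 'I_k -> X -> X)
    (w v : nat -> 'I_k) n m :
  ifs_branch f w n \o ifs_branch f v m =
  ifs_branch f (fun j => if (j < n)%N then w j else v (j - n)%N) (n + m).
Proof.
elim: m => [|m IHm]; last by rewrite addnS /= ltnNge leq_addr addKn -IHm.
by rewrite addn0; apply: eq_ifs_branch => j ->.
Qed.

(** Makes a semigroup element a finite prefix of an infinite sequence, whose later letters are
    arbitrary. The bound [1 <= n] places it among the terms of a fibre. *)
Lemma ifs_semigroup_branch (X : topologicalType) (k : nat) (f : 'I_k -> X -> X)
    (g : X -> X) :
  ifs_semigroup f g ->
  exists w n, (1 <= n)%N /\ g = ifs_branch f w n.
Proof.
elim=> [i|_ _ _ [w [n [n1 ->]]] _ [v [m [_ ->]]]]; first by exists (fun=> i), 1%N.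
exists (fun j => if (j < n)%N then w j else v (j - n)%N), (n + m)%N.
by rewrite ifs_branch_cat (leq_trans n1) ?leq_addr.
Qed.

Lemma ifs_semigroup_continuous (X : topologicalType) (k : nat)
    (f : 'I_k -> X -> X) (g : X -> X) :
  (forall i, continuous (f i)) -> ifs_semigroup f g -> continuous g.
Proof.
move=> fc; elim=> [i|g1 g2 _ g1c _ g2c] //.
by move=> x; apply: continuous_comp; [exact: g2c|exact: g1c].
Qed.

Theorem proposition3p13 (X : topologicalType) (k : nat) (f : 'I_k -> X -> X)
    (A : set X) :
  hausdorff_space X ->
  (forall i, continuous (f i)) ->
  quasi_attractor f A ->
  well_fibred f A ->
  (exists i, f i @` A <> A) ->
  strongly_fibred f A.
Proof.
move=> _ fc [_ Ac Af Aorb] wf [i fiA] U Uo [a [Ua Aa]].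
have Kc : compact (f i @` A).
  by apply: continuous_compact => //; exact: continuous_subspaceT.
have KA : f i @` A `<=` A by rewrite {2}Af => y fy; exists i.
pose C := [set h @^-1` U | h in ifs_semigroup f].
have Co V : C V -> open V.
  move=> [h hG <-]; apply: open_comp Uo => x _.
  exact: ifs_semigroup_continuous hG x.
have AC : A `<=` \bigcup_(V in C) V.
  (* The orbit closure is taken at [x], not at [a]: it contains [a], so the neighbourhood [U] of [a]
     meets the orbit of [x] at some [h x]. *)
  move=> x Ax; move: Aa; rewrite (Aorb x Ax) => /(_ U (open_nbhs_nbhs _)).
  move=> /(_ (conj Uo Ua)) [_ [[h hG <-] Uhx]].
  by exists (h @^-1` U) => //; exists h.
have [g gG [_ [h hG <-] gKU]] := wf _ Kc KA fiA C Co AC.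
have [w [n [n1 E]]] :=
  ifs_semigroup_branch (ifs_comp hG (ifs_comp gG (ifs_gen f i))).
(* The [n]-th term alone bounds the fibre: by [E] it is the image of [A] under [h \o (g \o f i)]. *)
exists w => x /(_ n n1); rewrite -E => -[y Ay <-].
by apply: gKU; exists (f i y) => //; exists y.
Qed.
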